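(* Let $D$ be an algebra with multiplication $\mu:D\otimes D\to D$ and let $T:D\otimes D\to D\otimes D$ be a linear map satisfying $T(1\otimes d)=1\otimes d$ and $T(d\otimes 1)=d\otimes 1$ for all $d\in D$, and $$\mu_{23}\circ T_{13}\circ T_{12}=T\circ\mu_{23}:D\otimes D\otimes D\to D\otimes D,$$ $$\mu_{12}\circ T_{13}\circ T_{23}=T\circ\mu_{12}:D\otimes D\otimes D\to D\otimes D,$$ $$T_{12}\circ T_{23}=T_{23}\circ T_{12}:D\otimes D\otimes D\to D\otimes D\otimes D.$$ Then the bilinear map $\mu\circ T:D\otimes D\to D$ is another associative algebra structure on the vector space $D$, with the same unit $1$.
   Context: $k$ is a field, $\otimes=\otimes_k$, and algebras are associative unital $k$-algebras. $T_{ij}$ denotes $T$ acting on the $i$-th and $j$-th tensor factors of $D\otimes D\otimes D$ (identity on the remaining factor); $\mu_{12}=\mu\otimes \mathrm{id}_D$ and $\mu_{23}=\mathrm{id}_D\otimes\mu$. (A map $T$ as in the statement is called a twistor for $D$, and the new algebra is denoted $D^T$.) *)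

(* Defs.v *)
From HB Require Import structures.
From mathcomp Require Import all_boot all_algebra.
From mathcomp Require Import boolp.
From mathcomp.multinomials Require Import freeg.

Set Implicit Arguments.
Unset Strict Implicit.
Unset Printing Implicit Defensive.

Import GRing.Theory.
Local Open Scope ring_scope.
Local Open Scope quotient_scope.

Reserved Notation "U ⊗ V" (at level 40, left associativity).
Reserved Notation "u ⊗ₜ v" (at level 40, left associativity).

(* The tensor product of two (arbitrary) vector spaces U and V is the free    *)
(* vector space on U * V modulo the subspace spanned by the bilinearity       *)
(* relations.                                                                 *)

Section TensorDef.
Variables (k : fieldType) (U V : lmodType k).

Inductive bilin_span : {freeg (U * V) / k} -> Prop :=
| bilin_span0 : bilin_span 0
| bilin_spanD x y : bilin_span x -> bilin_span y -> bilin_span (x + y)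
| bilin_spanZ a x : bilin_span x -> bilin_span (a *: x)
| bilin_span_l a u1 u2 v :
    bilin_span (<< (a *: u1 + u2, v) >> - (a *: << (u1, v) >> + << (u2, v) >>))
| bilin_span_r a u v1 v2 :
    bilin_span (<< (u, a *: v1 + v2) >> - (a *: << (u, v1) >> + << (u, v2) >>)).

Definition bilin_spanb (x : {freeg (U * V) / k}) : bool := `[< bilin_span x >].

Fact bilin_spanb_zmod_closed : zmod_closed bilin_spanb.
Proof.
split=> [|x y /asboolP sx /asboolP sy]; first exact/asboolP/bilin_span0.
by apply/asboolP/bilin_spanD; rewrite -?scaleN1r //; apply: bilin_spanZ.
Qed.

HB.instance Definition _ :=
  GRing.isZmodClosed.Build _ bilin_spanb bilin_spanb_zmod_closed.

Definition bilin_zmod : zmodClosed {freeg (U * V) / k} :=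
  GRing.ZmodClosed.clone _ bilin_spanb _.

Definition tensor : Type := Quotient.quot bilin_zmod.

HB.instance Definition _ := Choice.on tensor.
HB.instance Definition _ := GRing.Zmodule.on tensor.

Definition tensor_pi (x : {freeg (U * V) / k}) : tensor :=
  \pi_(Quotient.quot bilin_zmod) x.

Definition tensor_repr (x : tensor) : {freeg (U * V) / k} :=
  repr (x : Quotient.quot bilin_zmod).

Lemma tensor_reprK : cancel tensor_repr tensor_pi.
Proof. exact: reprK. Qed.

Lemma tensor_piP x y : tensor_pi x = tensor_pi y <-> bilin_span (x - y).
Proof.
split=> [/eqP|sxy]; first by rewrite -Quotient.idealrBE => /asboolP.
by apply/eqP; rewrite -Quotient.idealrBE; apply/asboolP.
Qed.

Fact tensor_pi_zmod_morphism : zmod_morphism tensor_pi.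
Proof. exact: (raddfB \pi_(Quotient.quot bilin_zmod)). Qed.

HB.instance Definition _ :=
  GRing.isZmodMorphism.Build _ _ tensor_pi tensor_pi_zmod_morphism.

Definition tensor_scale (a : k) (x : tensor) : tensor :=
  tensor_pi (a *: tensor_repr x).

Lemma tensor_scale_pi a x : tensor_scale a (tensor_pi x) = tensor_pi (a *: x).
Proof.
apply/tensor_piP; rewrite -scalerBr; apply/bilin_spanZ/tensor_piP.
exact: tensor_reprK.
Qed.

Fact tensor_scaleA a b x :
  tensor_scale a (tensor_scale b x) = tensor_scale (a * b) x.
Proof. by rewrite -[x]tensor_reprK !tensor_scale_pi scalerA. Qed.

Fact tensor_scale1 : left_id 1 tensor_scale.
Proof. by move=> x; rewrite -[x]tensor_reprK tensor_scale_pi scale1r. Qed.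

Fact tensor_scaleDr : right_distributive tensor_scale +%R.
Proof.
move=> a x y; rewrite -[x]tensor_reprK -[y]tensor_reprK.
by rewrite -raddfD !tensor_scale_pi scalerDr raddfD.
Qed.

Fact tensor_scaleDl x : {morph tensor_scale^~ x : a b / a + b}.
Proof.
move=> a b; rewrite -[x]tensor_reprK.
by rewrite !tensor_scale_pi scalerDl raddfD.
Qed.

HB.instance Definition _ := GRing.Zmodule_isLmodule.Build k tensor
  tensor_scaleA tensor_scale1 tensor_scaleDr tensor_scaleDl.

Fact tensor_pi_scalable : scalable tensor_pi.
Proof. by move=> a x; rewrite -tensor_scale_pi. Qed.

HB.instance Definition _ :=
  GRing.isScalable.Build _ _ _ _ tensor_pi tensor_pi_scalable.

Definition tens (u : U) (v : V) : tensor := tensor_pi << (u, v) >>.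

Fact tens_bilinear : bilinear_for *:%R *:%R tens.
Proof.
split=> [v a u1 u2|u a v1 v2]; rewrite /= /tens -linearP; apply/tensor_piP.
  exact: bilin_span_l.
exact: bilin_span_r.
Qed.

HB.instance Definition _ :=
  bilinear_isBilinear.Build k U V tensor _ _ tens tens_bilinear.

Lemma tensor_ind (P : tensor -> Prop) :
    (forall u v, P (tens u v)) -> P 0 ->
    (forall a x y, P x -> P y -> P (a *: x + y)) ->
  forall x, P x.
Proof.
move=> Pt P0 PD x; rewrite -[x]tensor_reprK -[tensor_repr x]freeg_sumE.
elim: (dom _) => [|[u v] s IHs]; first by rewrite big_nil raddf0.
rewrite big_cons raddfD /=.
suff ->: << coeff (u, v) (tensor_repr x) *g (u, v) >> =
         coeff (u, v) (tensor_repr x) *: << (u, v) >> :> {freeg (U * V) / k}.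
  by rewrite linearZ; apply: PD (Pt u v) IHs.
by apply/eqP/freeg_eqP => z; rewrite coeffZ !coeffU mul1r.
Qed.

End TensorDef.

Notation "U ⊗ V" := (tensor U V) : type_scope.
Notation "u ⊗ₜ v" := (tens u v) : ring_scope.

Lemma eq_tensor_linear (k : fieldType) (U V W : lmodType k)
    (f g : {linear U ⊗ V -> W}) :
  (forall u v, f (u ⊗ₜ v) = g (u ⊗ₜ v)) -> f =1 g.
Proof.
move=> efg; elim/tensor_ind => [//||a x y IHx IHy]; first by rewrite !linear0.
by rewrite !linearP IHx IHy.
Qed.

Section TensorLift.
Variables (k : fieldType) (U V W : lmodType k) (f : {bilinear U -> V -> W}).

Let flift : {freeg (U * V) / k} -> W := fglift (fun p => f p.1 p.2).

Let flift_linear : linear flift.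
Proof.
have fliftB : zmod_morphism flift := lift_is_additive _.
pose F := GRing.isZmodMorphism.Build _ _ flift fliftB.
pose fA : {additive {freeg (U * V) / k} -> W} := HB.pack flift F.
move=> a x y; rewrite -[flift]/(fA : _ -> _) raddfD; congr (_ + _).
have [s [c ->]] : exists (s : seq (U * V)) (c : U * V -> k),
    x = \sum_(p <- s) << c p *g p >>.
  by exists (dom x), (fun p => coeff p x); rewrite freeg_sumE.
rewrite scaler_sumr [LHS]raddf_sum [fA _ in RHS]raddf_sum scaler_sumr.
apply: eq_bigr => p _ /=.
have ->: a *: << c p *g p >> = << a * c p *g p >>
    :> {freeg (U * V) / k}.
  by apply/eqP/freeg_eqP => z; rewrite coeffZ !coeffU mulrA.
by rewrite /flift !liftU scalerA.
Qed.

Definition tensor_lift (x : U ⊗ V) : W := flift (tensor_repr x).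

Let flift_span x : bilin_span x -> flift x = 0.
Proof.
pose F := GRing.isLinear.Build _ _ _ _ flift flift_linear.
pose fL : {linear {freeg (U * V) / k} -> W} := HB.pack flift F.
have fLU p : fL << p >> = f p.1 p.2.
  by rewrite /= /flift liftU scale1r.
rewrite -[flift]/(fL : _ -> _).
elim=> [|y z _ y0 _ z0|a y _ y0|a u1 u2 v|a u v1 v2].
- exact: linear0.
- by rewrite linearD y0 z0 addr0.
- by rewrite linearZ_LR y0 scaler0.
- by rewrite linearB linearD linearZ_LR !fLU /= linearPl subrr.
- by rewrite linearB linearD linearZ_LR !fLU /= linearPr subrr.
Qed.

Let tensor_lift_pi x : tensor_lift (tensor_pi x) = flift x.
Proof.
have /tensor_piP/flift_span := tensor_reprK (tensor_pi x).
by move/eqP; rewrite -scaleN1r addrC flift_linear scaleN1r addrC subr_eq0 => /eqP.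
Qed.

Lemma tensor_liftE u v : tensor_lift (u ⊗ₜ v) = f u v.
Proof. by rewrite tensor_lift_pi /flift liftU scale1r. Qed.

Fact tensor_lift_linear : linear tensor_lift.
Proof.
move=> a x y; rewrite -[x]tensor_reprK -[y]tensor_reprK -linearP.
by rewrite !tensor_lift_pi flift_linear.
Qed.

HB.instance Definition _ :=
  GRing.isLinear.Build _ _ _ _ tensor_lift tensor_lift_linear.

End TensorLift.

Section TensorMap.
Variables (k : fieldType) (U V U' V' : lmodType k).
Variables (f : {linear U -> U'}) (g : {linear V -> V'}).

Definition tens_map (u : U) (v : V) : U' ⊗ V' := f u ⊗ₜ g v.

Fact tens_map_bilinear : bilinear_for *:%R *:%R tens_map.
Proof.
by split=> [v a x y|u a x y]; rewrite /tens_map /= linearP (linearPl, linearPr).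
Qed.

HB.instance Definition _ :=
  bilinear_isBilinear.Build k U V (U' ⊗ V') _ _ tens_map tens_map_bilinear.

Definition tensor_map : {linear U ⊗ V -> U' ⊗ V'} := tensor_lift tens_map.

Lemma tensor_mapE u v : tensor_map (u ⊗ₜ v) = f u ⊗ₜ g v.
Proof. exact: tensor_liftE. Qed.

End TensorMap.

Section TensorSwap.
Variables (k : fieldType) (U V : lmodType k).

Definition tens_swap (u : U) (v : V) : V ⊗ U := v ⊗ₜ u.

Fact tens_swap_bilinear : bilinear_for *:%R *:%R tens_swap.
Proof.
by split=> [v a x y|u a x y]; rewrite /tens_swap /= (linearPl, linearPr).
Qed.

HB.instance Definition _ :=
  bilinear_isBilinear.Build k U V (V ⊗ U) _ _ tens_swap tens_swap_bilinear.

Definition tensor_swap : {linear U ⊗ V -> V ⊗ U} := tensor_lift tens_swap.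

Lemma tensor_swapE u v : tensor_swap (u ⊗ₜ v) = v ⊗ₜ u.
Proof. exact: tensor_liftE. Qed.

End TensorSwap.

Section TensorAssoc.
Variables (k : fieldType) (U V W : lmodType k).

Definition tens_assoc (x : U ⊗ V) (w : W) : U ⊗ (V ⊗ W) :=
  tensor_map idfun (applyr (@tens k V W) w) x.

Fact tens_assoc_bilinear : bilinear_for *:%R *:%R tens_assoc.
Proof.
split=> [w a x y|x a w1 w2]; rewrite /= /tens_assoc; first exact: linearP.
elim/tensor_ind: x => [u v||b x y IHx IHy].
- by rewrite !tensor_mapE /= !linearPr.
- by rewrite !linear0 addr0.
- rewrite !(linearP (tensor_map _ _)) {}IHx {}IHy !scalerDr !scalerA mulrC -!addrA.
  by congr (_ + _); rewrite addrCA.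
Qed.

HB.instance Definition _ := bilinear_isBilinear.Build k (U ⊗ V) W
  (U ⊗ (V ⊗ W)) _ _ tens_assoc tens_assoc_bilinear.

Definition tensor_assoc : {linear (U ⊗ V) ⊗ W -> U ⊗ (V ⊗ W)} :=
  tensor_lift tens_assoc.

Lemma tensor_assocE u v w : tensor_assoc ((u ⊗ₜ v) ⊗ₜ w) = u ⊗ₜ (v ⊗ₜ w).
Proof.
transitivity (tens_assoc (u ⊗ₜ v) w); first exact: tensor_liftE.
exact: tensor_mapE.
Qed.

Definition tens_unassoc (u : U) (x : V ⊗ W) : (U ⊗ V) ⊗ W :=
  tensor_map ((@tens k U V : {bilinear U -> V -> U ⊗ V}) u) idfun x.

Fact tens_unassoc_bilinear : bilinear_for *:%R *:%R tens_unassoc.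
Proof.
split=> [x a u1 u2|u a x y]; rewrite /= /tens_unassoc; last exact: linearP.
elim/tensor_ind: x => [v w||b x y IHx IHy].
- by rewrite !tensor_mapE /= !linearPl.
- by rewrite !linear0 addr0.
- rewrite !(linearP (tensor_map _ _)) {}IHx {}IHy !scalerDr !scalerA mulrC -!addrA.
  by congr (_ + _); rewrite addrCA.
Qed.

HB.instance Definition _ := bilinear_isBilinear.Build k U (V ⊗ W)
  ((U ⊗ V) ⊗ W) _ _ tens_unassoc tens_unassoc_bilinear.

Definition tensor_unassoc : {linear U ⊗ (V ⊗ W) -> (U ⊗ V) ⊗ W} :=
  tensor_lift tens_unassoc.

Lemma tensor_unassocE u v w : tensor_unassoc (u ⊗ₜ (v ⊗ₜ w)) = (u ⊗ₜ v) ⊗ₜ w.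
Proof.
transitivity (tens_unassoc u (v ⊗ₜ w)); first exact: tensor_liftE.
exact: tensor_mapE.
Qed.

End TensorAssoc.

(* D ⊗ D ⊗ D is parsed as (D ⊗ D) ⊗ D.                                        *)

Section Legs.
Variables (k : fieldType) (D : lmodType k).

Definition swap23 : {linear D ⊗ D ⊗ D -> D ⊗ D ⊗ D} :=
  @tensor_unassoc k D D D \o tensor_map idfun (@tensor_swap k D D)
    \o @tensor_assoc k D D D.

Lemma swap23E x y z : swap23 (x ⊗ₜ y ⊗ₜ z) = x ⊗ₜ z ⊗ₜ y.
Proof.
by rewrite /= tensor_assocE tensor_mapE tensor_swapE tensor_unassocE.
Qed.

Variable T : {linear D ⊗ D -> D ⊗ D}.

Definition leg12 : {linear D ⊗ D ⊗ D -> D ⊗ D ⊗ D} := tensor_map T idfun.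

Definition leg23 : {linear D ⊗ D ⊗ D -> D ⊗ D ⊗ D} :=
  @tensor_unassoc k D D D \o tensor_map idfun T \o @tensor_assoc k D D D.

Definition leg13 : {linear D ⊗ D ⊗ D -> D ⊗ D ⊗ D} :=
  swap23 \o leg12 \o swap23.

Variable mu : {linear D ⊗ D -> D}.

Definition mul12 : {linear D ⊗ D ⊗ D -> D ⊗ D} := tensor_map mu idfun.

Definition mul23 : {linear D ⊗ D ⊗ D -> D ⊗ D} :=
  tensor_map idfun mu \o @tensor_assoc k D D D.

(* Unlike algType, this allows the zero algebra.                              *)
Definition algebra_structure (one : D) : Prop :=
  let mul x y := mu (x ⊗ₜ y) in
  [/\ associative mul, left_id one mul & right_id one mul].

End Legs.

Section AlgType.
Variables (k : fieldType) (A : algType k).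

Definition alg_mul (x y : A) : A := x * y.

Fact alg_mul_bilinear : bilinear_for *:%R *:%R alg_mul.
Proof.
split=> [y a x1 x2|x a y1 y2]; rewrite /= /alg_mul.
  by rewrite mulrDl scalerAl.
by rewrite mulrDr scalerAr.
Qed.

HB.instance Definition _ :=
  bilinear_isBilinear.Build k A A A _ _ alg_mul alg_mul_bilinear.

Lemma algType_structure : algebra_structure (tensor_lift alg_mul) (1 : A).
Proof.
split=> [x y z|x|x]; rewrite /= !tensor_liftE /= /alg_mul.
- exact: mulrA.
- exact: mul1r.
- exact: mulr1.
Qed.

End AlgType.

(* Main.v *)
Require Import Defs.
From mathcomp Require Import all_boot all_algebra.

(* Both bracketings of the product mu \o T reduce to mu applied to a two-fold *)
(* multiplication of T13 T12 T23: (xy)z is mu mu12 T13 T23 T12, x(yz) is      *)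
(* mu mu23 T13 T12 T23, and these agree because mu is associative and T12     *)
(* commutes with T23.                                                         *)

Local Open Scope ring_scope.

Import GRing.Theory.

(** The inner product of each bracketing is a leg of [T] followed by a multiplication
    ([mul23_leg23E], [mul12_leg12E]). The two multiplication axioms then pull the outer [T] back
    through that multiplication, so all twisting happens on the triple tensor before anything is
    multiplied. *)

Lemma tensor_unassocK (k : fieldType) (U V W : lmodType k) :
  cancel (@tensor_unassoc k U V W) (@tensor_assoc k U V W).
Proof.
elim/tensor_ind => [u x||a x y IHx IHy]; last by rewrite !linearP IHx IHy.
  elim/tensor_ind: x => [v w||a x y IHx IHy].
  - by rewrite tensor_unassocE tensor_assocE.
  - by rewrite linear0r !linear0.
  - by rewrite linearPr !linearP IHx IHy.
by rewrite !linear0.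
Qed.

(** Since [T (y ⊗ₜ z)] need not be a pure tensor, the reassociations inside [leg23] and [mul23] must
    cancel on arbitrary tensors, whence [tensor_unassocK]. *)
Lemma mul23_leg23E (k : fieldType) (D : lmodType k) (mu : {linear D ⊗ D -> D})
    (T : {linear D ⊗ D -> D ⊗ D}) x y z :
  mul23 mu (leg23 T (x ⊗ₜ y ⊗ₜ z)) = x ⊗ₜ mu (T (y ⊗ₜ z)).
Proof.
rewrite /= tensor_assocE tensor_mapE.
by rewrite (tensor_unassocK _ _ _ _ (x ⊗ₜ T (y ⊗ₜ z))) tensor_mapE.
Qed.

Lemma mul12_leg12E (k : fieldType) (D : lmodType k) (mu : {linear D ⊗ D -> D})
    (T : {linear D ⊗ D -> D ⊗ D}) x y z :
  mul12 mu (leg12 T (x ⊗ₜ y ⊗ₜ z)) = mu (T (x ⊗ₜ y)) ⊗ₜ z.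
Proof. by rewrite !tensor_mapE. Qed.

(** Associativity of [mu] has to be applied to twisted, hence generally non-pure, triple tensors; it
    extends to them by linearity. *)
Lemma mul12_mul23 (k : fieldType) (D : lmodType k) (mu : {linear D ⊗ D -> D}) :
    associative (fun x y => mu (x ⊗ₜ y)) ->
  mu \o mul12 mu =1 mu \o mul23 mu.
Proof.
move=> muA; apply: eq_tensor_linear => x z /=.
(* Only the outer tensor has been split so far: [x] still ranges over [D ⊗ D]. *)
elim/tensor_ind: x => [x y||a x y IHx IHy].
- by rewrite tensor_assocE !tensor_mapE /= muA.
- by rewrite linear0l !linear0.
- by rewrite linearPl !linearP IHx IHy.
Qed.

Theorem theorem3p2 (k : fieldType) (D : lmodType k)
    (mu : {linear D ⊗ D -> D}) (one : D)
    (D_alg : algebra_structure mu one)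
    (T : {linear D ⊗ D -> D ⊗ D})
    (T1d : forall d : D, T (one ⊗ₜ d) = one ⊗ₜ d)
    (Td1 : forall d : D, T (d ⊗ₜ one) = d ⊗ₜ one)
    (T_mu23 : mul23 mu \o leg13 T \o leg12 T =1 T \o mul23 mu)
    (T_mu12 : mul12 mu \o leg13 T \o leg23 T =1 T \o mul12 mu)
    (T_comm : leg12 T \o leg23 T =1 leg23 T \o leg12 T) :
  algebra_structure (mu \o T) one.
Proof.
have [muA mu1 mur1] := D_alg.
split=> [x y z|d|d]; [|by rewrite /= T1d mu1|by rewrite /= Td1 mur1].
pose t : D ⊗ D ⊗ D := x ⊗ₜ y ⊗ₜ z.
have E1 : T (x ⊗ₜ mu (T (y ⊗ₜ z))) = mul23 mu (leg13 T (leg12 T (leg23 T t))).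
  by rewrite -mul23_leg23E; exact: (esym (T_mu23 _)).
have E2 : T (mu (T (x ⊗ₜ y)) ⊗ₜ z) = mul12 mu (leg13 T (leg23 T (leg12 T t))).
  by rewrite -mul12_leg12E; exact: (esym (T_mu12 _)).
rewrite [LHS](congr1 mu E1) [RHS](congr1 mu E2).
have /= -> := T_comm t.
exact: (esym (mul12_mul23 _ _ _ muA _)).
Qed.
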